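(* Let $B\supseteq C$ be a unital inclusion of $C^*$-algebras, $\theta:C\to B$ an injective unital $*$-homomorphism, and $A=B\bigstar_C^{\mathrm{univ}}\theta$ the universal HNN extension with stable unitary $u(\theta)$. Let $$\mathcal{A}:=\big(B\otimes M_2(\mathbf{C}):\iota_\theta\big)\bigstar^{\mathrm{univ}}_{C\oplus C}\big(C\otimes M_2(\mathbf{C}):\iota_1\big)$$ be the universal amalgamated free product of $C^*$-algebras over $C\oplus C$ via the embeddings $\iota_\theta((c_1,c_2))=\begin{bmatrix}c_1&0\\0&\theta(c_2)\end{bmatrix}$ and $\iota_1((c_1,c_2))=\begin{bmatrix}c_1&0\\0&c_2\end{bmatrix}$, with canonical embeddings $j_\theta:B\otimes M_2(\mathbf{C})\to\mathcal{A}$ and $j_1:C\otimes M_2(\mathbf{C})\to\mathcal{A}$ (so $j_\theta\circ\iota_\theta=j_1\circ\iota_1$). Then there is a bijective $*$-homomorphism $\Phi:\mathcal{A}\to A\otimes M_2(\mathbf{C})$ such that $$\Phi\Big(j_1\Big(\begin{bmatrix}0&1\\0&0\end{bmatrix}\Big)j_\theta\Big(\begin{bmatrix}0&0\\1&0\end{bmatrix}\Big)\Big)=\begin{bmatrix}u(\theta)&0\\0&0\end{bmatrix},\quad \Phi\Big(j_\theta\Big(\begin{bmatrix}b&0\\0&0\end{bmatrix}\Big)\Big)=\begin{bmatrix}b&0\\0&0\end{bmatrix}\ (b\in B),\quad \Phi\Big(j_\theta\Big(\begin{bmatrix}0&1\\0&0\end{bmatrix}\Big)\Big)=\begin{bm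atrix}0&1\\0&0\end{bmatrix}.$$
   Context: The universal HNN extension $B\bigstar_C^{\mathrm{univ}}\theta$ is the universal $C^*$-algebra generated by $B$ and a single unitary $u(\theta)$ subject only to the relations $u(\theta)\theta(c)u(\theta)^*=c$ for all $c\in C$ (the unit of $B$ being the unit of the algebra). The universal amalgamated free product of unital $C^*$-algebras $P_1,P_2$ over $Q$ via unital embeddings $\iota_i:Q\to P_i$ is the universal $C^*$-algebra generated by copies $j_1(P_1),j_2(P_2)$ with $j_1\circ\iota_1=j_2\circ\iota_2$ (pushout in unital $C^*$-algebras). Elements of $B\otimes M_2(\mathbf{C})$ are written as $2\times 2$ matrices over $B$. *)

(* Defs.v *)
From HB Require Import structures.
From mathcomp Require Import all_boot all_order all_algebra.
From mathcomp Require Import complex.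
From mathcomp Require Import all_classical all_reals all_analysis.

Set Implicit Arguments.
Unset Strict Implicit.
Unset Printing Implicit Defensive.

Import Order.TTheory GRing.Theory Num.Theory.
Import numFieldNormedType.Exports.

Import Normc.

Local Open Scope classical_set_scope.
Local Open Scope ring_scope.
Local Open Scope complex_scope.

(* Algebras are unital and, as in the library, satisfy 1 != 0. *)
HB.mixin Record isStarAlgebra (K : numClosedFieldType) A of GRing.Algebra K A := {
  star : A -> A;
  starK : involutive star;
  starD : {morph star : x y / x + y};
  starZ : forall (a : K) (x : A), star (a *: x) = Num.conj a *: star x;
  starM : forall x y : A, star (x * y) = star y * star x
}.

#[short(type="starAlgType")]
HB.structure Definition StarAlgebra (K : numClosedFieldType) :=
  {A of GRing.Algebra K A & isStarAlgebra K A}.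

(* The norm is a field of the mixin because the library's hierarchy does not
   allow a structure extending both rings and [completeNormedModType]: their
   common superstructures are already joined in [numDomainType]. *)
HB.mixin Record isCStarAlgebra (R : realType) A of StarAlgebra R[i] A := {
  cnorm : A -> R;
  cnorm_eq0 : forall x : A, cnorm x = 0 -> x = 0;
  cnormD : forall x y : A, cnorm (x + y) <= cnorm x + cnorm y;
  cnormZ : forall (a : R[i]) (x : A), cnorm (a *: x) = normc a * cnorm x;
  cnormM : forall x y : A, cnorm (x * y) <= cnorm x * cnorm y;
  cnorm_star_mul : forall x : A, cnorm (star x * x) = cnorm x ^+ 2;
  cnorm_complete : forall s : nat -> A,
    (forall e : R, 0 < e -> exists N : nat, forall m n : nat,
        (N <= m)%N -> (N <= n)%N -> cnorm (s m - s n) < e) ->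
    exists l : A, (fun n => cnorm (s n - l)) @ \oo --> (0 : R)
}.

#[short(type="cstarAlgType")]
HB.structure Definition CStarAlgebra (R : realType) :=
  {A of StarAlgebra R[i] A & isCStarAlgebra R A}.

HB.mixin Record isStarMorphism (K : numClosedFieldType) (A B : starAlgType K)
    (f : A -> B) := {
  star_morph : forall x, f (star x) = star (f x)
}.

(* Unital *-homomorphisms. *)
HB.structure Definition StarHom (K : numClosedFieldType)
    (A B : starAlgType K) :=
  {f of @GRing.LRMorphism K A B *:%R f & isStarMorphism K A B f}.

Notation "{ 'starhom' A -> B }" := (@StarHom.type _ A%type B%type)
  (at level 0, A at level 98, B at level 99, format "{ 'starhom'  A  ->  B }")
  : type_scope.

Section Idfun.
Variables (K : numClosedFieldType) (A : starAlgType K).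

HB.instance Definition _ :=
  isStarMorphism.Build K A A idfun (fun=> erefl).

End Idfun.

Section DirectSum.
Variables (K : numClosedFieldType) (A B : starAlgType K).

Definition pair_star (x : A * B) : A * B := (star x.1, star x.2).

Fact pair_starK : involutive pair_star.
Proof. by case=> x y; rewrite /pair_star /= !starK. Qed.

Fact pair_starD : {morph pair_star : x y / x + y}.
Proof. by move=> x y; congr pair; apply: starD. Qed.

Fact pair_starZ (a : K) (x : A * B) :
  pair_star (a *: x) = Num.conj a *: pair_star x.
Proof. by congr pair; apply: starZ. Qed.

Fact pair_starM (x y : A * B) :
  pair_star (x * y) = pair_star y * pair_star x.
Proof. by congr pair; apply: starM. Qed.

HB.instance Definition _ := isStarAlgebra.Build K (A * B)%type
  pair_starK pair_starD pair_starZ pair_starM.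

End DirectSum.

(* [mat2 A] is A ⊗ M_2(C), an alias of ['M[A]_2] because the library's module
   structure on the latter has its scalars in A.  Only the *-algebra structure
   is given: when A is a C*-algebra, the C*-norm on this *-algebra exists and
   is unique, and no norm is needed to speak of *-homomorphisms. *)
Definition mat2 (A : Type) : Type := 'M[A]_2.

HB.instance Definition _ (A : nzRingType) :=
  GRing.NzRing.copy (mat2 A) 'M[A]_2.

Section Mat2.
Variables (K : numClosedFieldType) (A : starAlgType K).

Definition mat2_scale (a : K) (X : mat2 A) : mat2 A :=
  \matrix_(i, j) (a *: X i j).

Definition mat2_star (X : mat2 A) : mat2 A := \matrix_(i, j) star (X j i).

Fact mat2_scalerA (a b : K) (X : mat2 A) :
  mat2_scale a (mat2_scale b X) = mat2_scale (a * b) X.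
Proof. by apply/matrixP=> i j; rewrite !mxE scalerA. Qed.

Fact mat2_scale1r : left_id 1 mat2_scale.
Proof. by move=> X; apply/matrixP=> i j; rewrite !mxE scale1r. Qed.

Fact mat2_scalerDr : right_distributive mat2_scale +%R.
Proof. by move=> a X Y; apply/matrixP=> i j; rewrite !mxE scalerDr. Qed.

Fact mat2_scalerDl (X : mat2 A) : {morph mat2_scale^~ X : a b / a + b}.
Proof. by move=> a b; apply/matrixP=> i j; rewrite !mxE scalerDl. Qed.

HB.instance Definition _ := GRing.Zmodule_isLmodule.Build K (mat2 A)
  mat2_scalerA mat2_scale1r mat2_scalerDr mat2_scalerDl.

Fact mat2_scalerAl (a : K) (X Y : mat2 A) : a *: (X * Y) = (a *: X) * Y.
Proof.
apply/matrixP=> i j; rewrite !mxE scaler_sumr.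
by apply: eq_bigr => k _; rewrite !mxE scalerAl.
Qed.

HB.instance Definition _ := GRing.Lmodule_isLalgebra.Build K (mat2 A)
  mat2_scalerAl.

Fact mat2_scalerAr (a : K) (X Y : mat2 A) : a *: (X * Y) = X * (a *: Y).
Proof.
apply/matrixP=> i j; rewrite !mxE scaler_sumr.
by apply: eq_bigr => k _; rewrite !mxE scalerAr.
Qed.

HB.instance Definition _ := GRing.Lalgebra_isAlgebra.Build K (mat2 A)
  mat2_scalerAr.

Fact mat2_starK : involutive mat2_star.
Proof. by move=> X; apply/matrixP=> i j; rewrite !mxE starK. Qed.

Fact mat2_starD : {morph mat2_star : X Y / X + Y}.
Proof. by move=> X Y; apply/matrixP=> i j; rewrite !mxE starD. Qed.

Fact mat2_starZ (a : K) (X : mat2 A) :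
  mat2_star (a *: X) = Num.conj a *: mat2_star X.
Proof. by apply/matrixP=> i j; rewrite !mxE starZ. Qed.

Fact mat2_starM (X Y : mat2 A) :
  mat2_star (X * Y) = mat2_star Y * mat2_star X.
Proof.
apply/matrixP=> i j; rewrite !mxE !big_ord_recl !big_ord0 !addr0 starD !starM.
by rewrite !mxE.
Qed.

HB.instance Definition _ := isStarAlgebra.Build K (mat2 A)
  mat2_starK mat2_starD mat2_starZ mat2_starM.

End Mat2.

(* Rows (a b) and (c d). *)
Definition mx22 (A : Type) (a b c d : A) : mat2 A :=
  \matrix_(i, j) if i == ord0 then (if j == ord0 then a else b)
                 else (if j == ord0 then c else d).

Section DiagHom.
Variables (K : numClosedFieldType) (C B : starAlgType K).
Variables f g : {starhom C -> B}.

Definition diag_hom (c : C * C) : mat2 B := mx22 (f c.1) 0 0 (g c.2).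

Let mat2P (X Y : mat2 B) :
  [/\ X 0 0 = Y 0 0, X 0 1 = Y 0 1, X 1 0 = Y 1 0 & X 1 1 = Y 1 1] -> X = Y.
Proof.
case=> h00 h01 h10 h11; apply/matrixP=> i j.
have I2 (k : 'I_2) : (k = 0) + (k = 1).
  by case: k => [[|[|//]] hk]; [left | right]; apply: val_inj.
by case: (I2 i) => ->; case: (I2 j) => ->.
Qed.

Fact diag_hom_zmod_morphism : zmod_morphism diag_hom.
Proof.
by move=> c d; apply: mat2P; split; rewrite !mxE /= ?raddfB //= subr0.
Qed.

HB.instance Definition _ :=
  GRing.isZmodMorphism.Build (C * C)%type (mat2 B) diag_hom
    diag_hom_zmod_morphism.

Fact diag_hom_monoid_morphism : monoid_morphism diag_hom.
Proof.
split=> [|c d]; apply: mat2P; split;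
  rewrite !mxE /= ?rmorph1 ?rmorphM // !big_ord_recl big_ord0 !mxE /=;
  by rewrite ?(mulr0, mul0r, addr0, add0r).
Qed.

HB.instance Definition _ :=
  GRing.isMonoidMorphism.Build (C * C)%type (mat2 B) diag_hom
    diag_hom_monoid_morphism.

Fact diag_hom_scalable : scalable diag_hom.
Proof.
by move=> a c; apply: mat2P; split; rewrite !mxE /= ?linearZ ?scaler0.
Qed.

HB.instance Definition _ :=
  GRing.isScalable.Build K (C * C)%type (mat2 B) *:%R diag_hom
    diag_hom_scalable.

Fact star0 : star 0 = 0 :> B.
Proof. by apply: (addrI (star 0)); rewrite -starD !addr0. Qed.

Fact diag_hom_star (c : C * C) : diag_hom (star c) = star (diag_hom c).
Proof. by apply: mat2P; split; rewrite !mxE /= ?star_morph ?star0. Qed.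

HB.instance Definition _ :=
  isStarMorphism.Build K (C * C)%type (mat2 B) diag_hom diag_hom_star.

End DiagHom.

Definition unitary (K : numClosedFieldType) (A : starAlgType K) (u : A) : Prop :=
  u * star u = 1 /\ star u * u = 1.

(* [u] is a unitary satisfying u theta(c) u^* = c, where [jB] is the canonical
   map of [B] into the algebra and [incl] is the inclusion of [C] in [B]. *)
Definition hnn_relations (K : numClosedFieldType) (C B D : starAlgType K)
    (incl theta : {starhom C -> B}) (jB : {starhom B -> D}) (u : D) : Prop :=
  unitary u /\ forall c : C, u * jB (theta c) * star u = jB (incl c).

Definition universal_hnn (R : realType) (C B A : cstarAlgType R)
    (incl theta : {starhom C -> B}) (jB : {starhom B -> A}) (u : A) : Prop :=
  hnn_relations incl theta jB u /\
  forall (D : cstarAlgType R) (pi : {starhom B -> D}) (v : D),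
    hnn_relations incl theta pi v ->
    exists h : {starhom A -> D},
      [/\ forall b, h (jB b) = pi b, h u = v
        & forall h' : {starhom A -> D},
            (forall b, h' (jB b) = pi b) -> h' u = v -> h' =1 h].

(* [D] ranges over all C*-algebras.  The factors are only required to be
   *-algebras, since no norm enters the definition: *-homomorphisms between
   C*-algebras are automatically contractive. *)
Definition universal_amalgam (R : realType) (Q P1 P2 : starAlgType R[i])
    (A : cstarAlgType R) (i1 : {starhom Q -> P1}) (i2 : {starhom Q -> P2})
    (j1 : {starhom P1 -> A}) (j2 : {starhom P2 -> A}) : Prop :=
  (forall q, j1 (i1 q) = j2 (i2 q)) /\
  forall (D : cstarAlgType R) (f1 : {starhom P1 -> D}) (f2 : {starhom P2 -> D}),
    (forall q, f1 (i1 q) = f2 (i2 q)) ->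
    exists h : {starhom A -> D},
      [/\ forall x, h (j1 x) = f1 x, forall y, h (j2 y) = f2 y
        & forall h' : {starhom A -> D},
            (forall x, h' (j1 x) = f1 x) -> (forall y, h' (j2 y) = f2 y) ->
            h' =1 h].

(* Main.v *)
(* A C*-norm on [mat2 A] is needed to apply the universal property of [AA] to it:
   it is the operator norm of [mat2 A] acting on the Hilbert module [A^2], whose
   norm comes from the positivity of [x^* x].  Positivity is obtained without
   spectral theory: a self-adjoint [h] with [|1 - h| <= 1] is a square by a
   majorised iteration, and unitaries of the form [a + i s] give the converse.

   For the isomorphism, put [V = j1 e12 * jtheta e21], a unitary of the corner
   cut out by [jtheta e11], and amplify it to [v] commuting with the matrix units
   of [jtheta].  Then [b |-> jtheta (diag b b)] and [v] satisfy the HNN relations,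
   which gives [h : A -> AA]; conjugating by unitaries in the span of the units
   does not move the generators, so by uniqueness [h] commutes with the units and
   extends to [Psi : mat2 A -> AA].  In the other direction [Phi] is given by [jB]
   entrywise on [mat2 B], and on [mat2 C] by the entrywise inclusion conjugated by
   [diag 1 u^*].  The two are mutually inverse because they are so on generators. *)
From HB Require Import structures.
From Stdlib Require Import -(notations) Ncring Ncring_tac.
Require Import Defs.
From mathcomp Require Import all_boot all_order all_algebra.
From mathcomp Require Import complex.
From mathcomp Require Import all_classical all_reals all_analysis.
From mathcomp Require Import ring lra.

Set Implicit Arguments.
Unset Strict Implicit.
Unset Printing Implicit Defensive.

Import Order.TTheory GRing.Theory Num.Theory.
Import numFieldNormedType.Exports.
Import Normc.

Local Open Scope classical_set_scope.
Local Open Scope ring_scope.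

(** * Identities in noncommutative rings: the instances behind [non_commutative_ring] *)

Section NoncommutativeRing.
Variable A : nzRingType.

#[global] Instance nzRing_ops :
  @Ring_ops A 0 1 +%R *%R (fun x y => x - y) (@GRing.opp A) eq := {}.

#[global] Instance nzRing_Ring : @Ring A _ _ _ _ _ _ _ nzRing_ops.
Proof.
split; try exact _; rewrite /addition /multiplication /opposite /equality
  /zero /one /subtraction /=; intros; first [exact: addrC | exact: addrA
  | exact: add0r | exact: mulrA | exact: mul1r | exact: mulr1
  | exact: mulrDl | exact: mulrDr | exact: subrr | done
  | by move=> x y -> z t -> | by move=> x y ->].
Qed.

End NoncommutativeRing.

(** * Involution, real scalars and elementary norm estimates *)

Section StarAlgebraTheory.
Variables (K : numClosedFieldType) (A : starAlgType K).
Implicit Types x y : A.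

Lemma starN x : star (- x) = - star x.
Proof. by apply: (addrI (star x)); rewrite -starD !subrr star0. Qed.

Lemma starB x y : star (x - y) = star x - star y.
Proof. by rewrite starD starN. Qed.

Lemma star1 : star 1 = 1 :> A.
Proof. by rewrite -[LHS]mulr1 -[X in _ * X](starK 1) -starM mulr1 starK. Qed.

End StarAlgebraTheory.

Section RealScaling.
Variable R : realType.

Lemma normc_real (r : R) : normc r%:C%C = `|r|.
Proof. by rewrite /= expr0n addr0 sqrtr_sqr. Qed.

Lemma conj_real (r : R) : Num.conj (r%:C%C) = r%:C%C.
Proof. exact: conjc_real. Qed.

Lemma conj_imaginary : Num.conj ('i%C : R[i]) = - 'i%C.
Proof. by apply/eqP; rewrite eq_complex /= oppr0 !eqxx. Qed.

Lemma imaginary_sqr : 'i%C * 'i%C = -1 :> R[i].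
Proof. by rewrite -expr2 sqr_i. Qed.

Variable A : cstarAlgType R.
Implicit Types (x y : A) (r s : R).

Definition rscale r x : A := r%:C%C *: x.

Lemma rscaleA r s x : rscale r (rscale s x) = rscale (r * s) x.
Proof. by rewrite /rscale scalerA rmorphM. Qed.

Lemma rscale1 x : rscale 1 x = x.
Proof. by rewrite /rscale scale1r. Qed.

Lemma rscaleMl r x y : rscale r x * y = rscale r (x * y).
Proof. by rewrite /rscale scalerAl. Qed.

Lemma rscaleMr r x y : x * rscale r y = rscale r (x * y).
Proof. by rewrite /rscale scalerAr. Qed.

Lemma rscaleDr r x y : rscale r (x + y) = rscale r x + rscale r y.
Proof. by rewrite /rscale scalerDr. Qed.

Lemma rscaleBr r x y : rscale r (x - y) = rscale r x - rscale r y.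
Proof. by rewrite /rscale scalerBr. Qed.

Lemma rscaleDl r s x : rscale (r + s) x = rscale r x + rscale s x.
Proof. by rewrite /rscale rmorphD scalerDl. Qed.

Lemma rscale_star r x : star (rscale r x) = rscale r (star x).
Proof. by rewrite /rscale starZ conj_real. Qed.

Lemma cnorm_rscale r x : cnorm (rscale r x) = `|r| * cnorm x.
Proof. by rewrite cnormZ normc_real. Qed.

Lemma rscale_half x : rscale 2^-1 (x + x) = x.
Proof. by rewrite rscaleDr -rscaleDl (_ : 2^-1 + 2^-1 = 1) ?rscale1 //; field. Qed.

End RealScaling.

Section NormTheory.
Variables (R : realType) (A : cstarAlgType R).
Implicit Types x y : A.

Lemma cnorm0 : cnorm (0 : A) = 0.
Proof. by rewrite -(scale0r (0 : A)) cnormZ normc_real normr0 mul0r. Qed.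

Lemma cnormN x : cnorm (- x) = cnorm x.
Proof.
by rewrite -scaleN1r cnormZ -(rmorphN1 (real_complex R)) normc_real normrN1 mul1r.
Qed.

(** Not an axiom of the norm: it comes from [0 = |x - x| <= 2 |x|]. *)
Lemma cnorm_ge0 x : 0 <= cnorm x.
Proof. by have := cnormD x (- x); rewrite subrr cnorm0 cnormN; lra. Qed.

Lemma cnormB x y : cnorm (x - y) <= cnorm x + cnorm y.
Proof. by rewrite -[cnorm y]cnormN; exact: cnormD. Qed.

Lemma cnorm_gt0 x : x != 0 -> 0 < cnorm x.
Proof.
move=> x0; rewrite lt_neqAle cnorm_ge0 andbT eq_sym.
by apply: contra_neq x0; exact: cnorm_eq0.
Qed.

(** The C*-identity and submultiplicativity give [|y|^2 <= |y^*| |y|]; divide by [|y|], then apply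
    this to [y^*] as well. *)
Lemma cnorm_star x : cnorm (star x) = cnorm x.
Proof.
suff le y : cnorm y <= cnorm (star y).
  by apply/eqP; rewrite eq_le le -{2}(starK x) le.
have [->|y0] := eqVneq y 0; first by rewrite star0.
by rewrite -(ler_pM2r (cnorm_gt0 y0)) -expr2 -cnorm_star_mul cnormM.
Qed.

Lemma cnorm1 : cnorm (1 : A) = 1.
Proof.
have := cnorm_star_mul (1 : A); rewrite star1 mulr1 expr2.
have := cnorm_gt0 (oner_neq0 A) => n0 e.
by apply: (mulfI (lt0r_neq0 n0)); rewrite mulr1.
Qed.

(** With [le_add_small], replaces passages to the limit by estimates linear in an error [e]. *)
Lemma cnorm_small_eq0 (c : R) x :
  (forall e, 0 < e -> e <= 1 -> cnorm x <= c * e) -> x = 0.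
Proof.
move=> h; apply: cnorm_eq0; apply/eqP; rewrite eq_le cnorm_ge0 andbT.
have c0 : 0 <= c by have := h 1 ltr01 (lexx _); have := cnorm_ge0 x; lra.
rewrite leNgt; apply/negP => x0.
have d0 : 0 < 1 + c + cnorm x by lra.
have e0 : 0 < cnorm x / (1 + c + cnorm x) by rewrite divr_gt0.
have e1 : cnorm x / (1 + c + cnorm x) <= 1 by rewrite ler_pdivrMr//; lra.
have := h _ e0 e1; rewrite mulrA ler_pdivlMr// => H; nra.
Qed.

Lemma le_add_small (a b c : R) :
  (forall e, 0 < e -> e <= 1 -> a <= b + c * e) -> a <= b.
Proof.
move=> h; rewrite leNgt; apply/negP => ab.
have d0 : 0 < 1 + `|c| + (a - b) by have := normr_ge0 c; lra.
have e0 : 0 < (a - b) / (1 + `|c| + (a - b)) by rewrite divr_gt0//; lra.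
have e1 : (a - b) / (1 + `|c| + (a - b)) <= 1.
  by rewrite ler_pdivrMr//; have := normr_ge0 c; lra.
have := h _ e0 e1; rewrite mulrA -lerBlDl ler_pdivlMr//.
by have := ler_norm c; nra.
Qed.

End NormTheory.

(** * Positivity in C*-algebras *)

Section SquareRoot.
Variables (R : realType) (A : cstarAlgType R).
Implicit Types x y z t r : A.

Definition sqrt_majorant (n : nat) : R := iter n (fun s => 2^-1 * (1 + s ^+ 2)) 0.

(* Approximates [1 - sqrt (1 - t)]; [sqrt_majorant] is the case [t = 1] over [R]. *)
Definition sqrt_approx t (n : nat) : A :=
  iter n (fun s => rscale 2^-1 (t + s * s)) 0.

Lemma sqrt_majorant_ge0 n : 0 <= sqrt_majorant n.
Proof.
elim: n => [|n ih] //=; have := sqr_ge0 (sqrt_majorant n).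
by rewrite /sqrt_majorant; lra.
Qed.

Lemma sqrt_majorant_le1 n : sqrt_majorant n <= 1.
Proof.
elim: n => [|n ih] /=; first by rewrite ler01.
by have := sqrt_majorant_ge0 n; rewrite -/(sqrt_majorant n); nra.
Qed.

(** [N] indexes a term within [e] of the supremum of this bounded sequence. *)
Lemma sqrt_majorant_cauchy (e : R) : 0 < e -> exists N : nat,
  forall n, (N <= n)%N -> sqrt_majorant n - sqrt_majorant N < e.
Proof.
move=> e0.
have sS : has_sup (range sqrt_majorant).
  by split; [exists 0; exists 0%N | exists 1 => _ [n _ <-]; exact: sqrt_majorant_le1].
have [_ [N _ <-] hN] := sup_adherent e0 sS.
exists N => n _; have := ub_le_sup sS.2 (imageT sqrt_majorant n); lra.
Qed.

Section Approx.
Variable t : A.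
Hypotheses (t_sa : star t = t) (t_le1 : cnorm t <= 1).

Lemma sqrt_approx_comm z n : z * t = t * z ->
  z * sqrt_approx t n = sqrt_approx t n * z.
Proof.
move=> zt; elim: n => [|n ih] /=; first by rewrite mulr0 mul0r.
rewrite -/(sqrt_approx t n) rscaleMl rscaleMr mulrDl mulrDr zt.
by rewrite mulrA ih -mulrA ih mulrA.
Qed.

Lemma sqrt_approx_sa n : star (sqrt_approx t n) = sqrt_approx t n.
Proof.
elim: n => [|n ih] /=; first by rewrite star0.
by rewrite rscale_star starD starM -/(sqrt_approx t n) ih t_sa.
Qed.

Lemma sqrt_approx_le n : cnorm (sqrt_approx t n) <= sqrt_majorant n.
Proof.
elim: n => [|n ih] /=; first by rewrite cnorm0.
rewrite cnorm_rscale -/(sqrt_approx t n) -/(sqrt_majorant n).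
rewrite ger0_norm ?invr_ge0 ?ler0n// ler_pM2l ?invr_gt0 ?ltr0n//.
have := cnormD t (sqrt_approx t n * sqrt_approx t n).
have := cnormM (sqrt_approx t n) (sqrt_approx t n).
have := cnorm_ge0 (sqrt_approx t n); have := t_le1; nra.
Qed.

(** Successive approximants [r], [s] commute, being built from [t], so the next increment is
    [(s - r) (s + r) / 2]. The majorant has the same factorisation, which carries the bound from one
    increment to the next. *)
Lemma sqrt_approx_succ n : cnorm (sqrt_approx t n.+1 - sqrt_approx t n) <=
  sqrt_majorant n.+1 - sqrt_majorant n.
Proof.
elim: n => [|n ih].
  rewrite /= subr0 mulr0 addr0 cnorm_rscale expr0n addr0 subr0.
  rewrite ger0_norm ?invr_ge0 ?ler0n//; have := t_le1; lra.
set r := sqrt_approx t n; set s := sqrt_approx t n.+1.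
have rs : r * s = s * r.
  by apply: sqrt_approx_comm; apply/esym; exact: sqrt_approx_comm.
have -> : sqrt_approx t n.+2 - s = rscale 2^-1 ((s - r) * (s + r)).
  rewrite {2}/s /= -/s -/(sqrt_approx t n) -/r -rscaleBr; congr rscale.
  transitivity (s * s - r * r); first non_commutative_ring.
  by rewrite mulrDr !mulrBl rs; non_commutative_ring.
rewrite cnorm_rscale ger0_norm ?invr_ge0 ?ler0n//.
have -> : sqrt_majorant n.+2 - sqrt_majorant n.+1 = 2^-1 *
   ((sqrt_majorant n.+1 - sqrt_majorant n) * (sqrt_majorant n.+1 + sqrt_majorant n)).
  by rewrite /= -/(sqrt_majorant n); field.
rewrite ler_pM2l ?invr_gt0 ?ltr0n//; apply: (le_trans (cnormM _ _)).
apply: ler_pM => //; try exact: cnorm_ge0.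
by apply: (le_trans (cnormD _ _)); apply: lerD; exact: sqrt_approx_le.
Qed.

Lemma sqrt_approx_dist m n : (m <= n)%N ->
  cnorm (sqrt_approx t n - sqrt_approx t m) <= sqrt_majorant n - sqrt_majorant m.
Proof.
move=> /subnKC <-; elim: (n - m)%N => [|k ih].
  by rewrite addn0 !subrr cnorm0.
rewrite addnS; have := sqrt_approx_succ (m + k).
have := cnormD (sqrt_approx t (m + k).+1 - sqrt_approx t (m + k))
  (sqrt_approx t (m + k) - sqrt_approx t m).
rewrite addrA subrK; lra.
Qed.

(** Two consecutive approximants are close to [r] at once, so that the recursion can be passed to
    the limit. *)
Lemma sqrt_approx_cvg : exists r, forall e : R, 0 < e -> exists n : nat,
  cnorm (sqrt_approx t n - r) <= e /\ cnorm (sqrt_approx t n.+1 - r) <= e.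
Proof.
have cau (e : R) : 0 < e -> exists N : nat, forall m n : nat,
    (N <= m)%N -> (N <= n)%N -> cnorm (sqrt_approx t m - sqrt_approx t n) < e.
  move=> e0; have [|N hN] := @sqrt_majorant_cauchy (e / 2); first by lra.
  exists N => m n Nm Nn.
  have := cnormB (sqrt_approx t m - sqrt_approx t N) (sqrt_approx t n - sqrt_approx t N).
  have := sqrt_approx_dist Nm; have := sqrt_approx_dist Nn.
  by have := hN _ Nm; have := hN _ Nn; rewrite opprB addrA subrK; lra.
have [r hr] := cnorm_complete _ cau; exists r => e e0.
have [N _ hN] := cvgr0_norm_le _ hr e e0.
exists N; split; apply: le_trans (ler_norm _) _; apply: hN => //=.
Qed.

(** In the limit the recursion reads [2 r = t + r^2], that is [(1 - r)^2 = 1 - t]. The last clause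
    holds because every approximant commutes with whatever commutes with [t]. *)
Lemma sqrt_exists : exists r, [/\ star r = r, cnorm r <= 1, r + r = t + r * r
  & forall z, z * t = t * z -> z * r = r * z].
Proof.
have [r hr] := sqrt_approx_cvg; exists r.
have nr : cnorm r <= 1.
  apply: (@le_add_small _ _ _ 1) => e e0 _; have [n [hn _]] := hr e e0.
  have := cnormB (sqrt_approx t n) (sqrt_approx t n - r).
  rewrite subKr; have := sqrt_approx_le n; have := sqrt_majorant_le1 n; lra.
split=> //.
- apply: subr0_eq; apply: (@cnorm_small_eq0 _ _ 2) => e e0 _.
  have [n [hn _]] := hr e e0.
  have -> : star r - r = (sqrt_approx t n - r) - star (sqrt_approx t n - r).
    by rewrite starB sqrt_approx_sa; non_commutative_ring.
  have := cnormB (sqrt_approx t n - r) (star (sqrt_approx t n - r)).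
  by rewrite cnorm_star; lra.
- apply: subr0_eq; apply: (@cnorm_small_eq0 _ _ 4) => e e0 _.
  have [n [hn hn1]] := hr e e0.
  set s := sqrt_approx t n in hn; set s' := sqrt_approx t n.+1 in hn1.
  have e2 : s' + s' = t + s * s.
    by rewrite /s' /= -/s -rscaleDr rscale_half.
  (* The recursion [2 s' = t + s^2] eliminates [t] and leaves four error terms, each of norm at most
     [e]. *)
  have -> : r + r - (t + r * r) =
      ((s - r) * s + r * (s - r)) - ((s' - r) + (s' - r)).
    transitivity (r + r - (s' + s') + s * s - r * r); last first.
      non_commutative_ring.
    by rewrite e2; non_commutative_ring.
  apply: (le_trans (cnormB _ _)).
  have := cnormD ((s - r) * s) (r * (s - r)).
  have := cnormD (s' - r) (s' - r).
  have := cnormM (s - r) s; have := cnormM r (s - r).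
  have : cnorm s <= 1 by apply: le_trans (sqrt_approx_le n) (sqrt_majorant_le1 n).
  have := cnorm_ge0 s; have := cnorm_ge0 r; have := cnorm_ge0 (s - r).
  nra.
- move=> z zt; apply: subr0_eq.
  apply: (@cnorm_small_eq0 _ _ (2 * cnorm z)) => e e0 _.
  have [n [hn _]] := hr e e0; have zs := sqrt_approx_comm n zt.
  set s := sqrt_approx t n in hn zs.
  have -> : z * r - r * z = (s - r) * z - z * (s - r).
    by rewrite mulrBl mulrBr zs; non_commutative_ring.
  apply: (le_trans (cnormB _ _)).
  have := cnormM (s - r) z; have := cnormM z (s - r).
  have := cnorm_ge0 z; have := cnorm_ge0 (s - r); nra.
Qed.

End Approx.
End SquareRoot.

(** * Positive elements and the order they define *)

Section Positivity.
Variables (R : realType) (A : cstarAlgType R).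
Implicit Types (a b h s x y z : A) (r c : R).

Lemma cnorm_sqr_sa a : star a = a -> cnorm (a * a) = cnorm a ^+ 2.
Proof. by move=> sa; rewrite -{1}sa cnorm_star_mul. Qed.

(** [u = a + i s] satisfies [u^* u = a^2 + s^2] and has real part [a], whence [|a| <= |u|]. *)
Lemma cnorm_le_sum_squares a s : star a = a -> star s = s -> a * s = s * a ->
  cnorm a ^+ 2 <= cnorm (a * a + s * s).
Proof.
move=> sa ss as_comm.
pose u := a + 'i%C *: s.
have us : star u = a - 'i%C *: s by rewrite /u starD starZ sa ss conj_imaginary scaleNr.
have <- : star u * u = a * a + s * s.
  rewrite us /u mulrBl !mulrDr -!(scalerAl, scalerAr) as_comm scalerA.
  by rewrite imaginary_sqr scaleN1r; non_commutative_ring.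
rewrite cnorm_star_mul ler_sqr ?nnegrE ?cnorm_ge0//.
have -> : a = rscale 2^-1 (u + star u).
  by rewrite us /u addrACA subrr addr0 rscale_half.
rewrite cnorm_rscale ger0_norm ?invr_ge0 ?ler0n//.
by have := cnormD u (star u); rewrite cnorm_star; lra.
Qed.

(** Self-adjoint squares avoid any appeal to the spectrum; [positive_star_mul] shows that all
    [x^* x] are of this form. *)
Definition positive h := exists s, star s = s /\ h = s * s.

Lemma positive_sa h : positive h -> star h = h.
Proof. by move=> [s [ss ->]]; rewrite starM ss. Qed.

Lemma sqrt_of_near1 h : star h = h -> cnorm (1 - h) <= 1 ->
  exists s, [/\ star s = s, s * s = h, cnorm (1 - s) <= 1
    & forall z, z * h = h * z -> z * s = s * z].
Proof.
move=> sh h1; have [|r [sr r1 r2 rc]] := sqrt_exists _ h1.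
  by rewrite starB star1 sh.
exists (1 - r); split.
- by rewrite starB star1 sr.
- transitivity (1 - (r + r) + r * r); first non_commutative_ring.
  by rewrite r2; non_commutative_ring.
- by rewrite subKr.
- move=> z zh; rewrite mulrBr mulrBl mulr1 mul1r rc//.
  by rewrite mulrBr mulrBl mulr1 mul1r zh.
Qed.

(* With [s] a square root of [1 - a^2], the element [a + i s] is unitary. *)
Lemma cnorm_1Bsqr_le1 a : star a = a -> cnorm a <= 1 -> cnorm (1 - a * a) <= 1.
Proof.
move=> sa a1.
have [||s [ss s2 _ sc]] := @sqrt_of_near1 (1 - a * a).
- by rewrite starB star1 starM sa.
- rewrite subKr; apply: (le_trans (cnormM _ _)).
  by have := cnorm_ge0 a; nra.
have as_comm : a * s = s * a.
  by apply: sc; rewrite mulrBr mulrBl mulr1 mul1r mulrA.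
have := cnorm_le_sum_squares ss sa (esym as_comm).
by rewrite s2 subrK cnorm1 -s2 cnorm_sqr_sa.
Qed.

(** With [near1_positive], this makes positivity in the unit ball a norm inequality, which is convex
    in [h]. *)
Lemma positive_near1 h : positive h -> cnorm h <= 1 -> cnorm (1 - h) <= 1.
Proof.
move=> [s [ss ->]] s1; apply: cnorm_1Bsqr_le1 => //.
move: s1; rewrite cnorm_sqr_sa//; have := cnorm_ge0 s; nra.
Qed.

Lemma near1_positive h : star h = h -> cnorm (1 - h) <= 1 -> positive h.
Proof. by move=> sh /(sqrt_of_near1 sh)[s [ss <- _ _]]; exists s. Qed.

Lemma positive_rscale c h : 0 <= c -> positive h -> positive (rscale c h).
Proof.
move=> c0 [s [ss ->]]; exists (rscale (Num.sqrt c) s); split.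
  by rewrite rscale_star ss.
by rewrite rscaleMl rscaleMr rscaleA -[_ * Num.sqrt c]expr2 sqr_sqrtr.
Qed.

Lemma positive_rscaleP c h : 0 < c -> positive (rscale c h) -> positive h.
Proof.
move=> c0 /(@positive_rscale c^-1); rewrite rscaleA mulVf ?gt_eqF// rscale1.
by apply; rewrite invr_ge0 ltW.
Qed.

(** What is gained over the definition is a root commuting with the commutant of [h]. It comes from
    [sqrt_of_near1] after [h] is scaled into the unit ball. *)
Lemma positive_sqrt h : positive h -> exists s, [/\ star s = s, s * s = h
  & forall z, z * h = h * z -> z * s = s * z].
Proof.
move=> hp; pose c := 1 + cnorm h.
have c0 : 0 < c by rewrite /c; have := cnorm_ge0 h; lra.
have c'0 : 0 <= c^-1 by rewrite invr_ge0 ltW.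
have hc : positive (rscale c^-1 h) by exact: positive_rscale.
have [|s [ss s2 _ sc]] := sqrt_of_near1 (positive_sa hc).
  apply: positive_near1 => //; rewrite cnorm_rscale ger0_norm//.
  by rewrite mulrC ler_pdivrMr// mul1r /c; lra.
exists (rscale (Num.sqrt c) s); split.
- by rewrite rscale_star ss.
- rewrite rscaleMl rscaleMr rscaleA -[_ * Num.sqrt c]expr2 sqr_sqrtr ?ltW// s2 rscaleA.
  by rewrite divff ?gt_eqF// rscale1.
- move=> z zh; rewrite rscaleMl rscaleMr sc//.
  by rewrite rscaleMl rscaleMr zh.
Qed.

(** After a common scaling both summands lie within distance 1 of the unit, hence so does their
    average. *)
Lemma positiveD a b : positive a -> positive b -> positive (a + b).
Proof.
move=> ap bp; pose c := (1 + cnorm a + cnorm b)^-1.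
have c0 : 0 < c.
  by rewrite /c invr_gt0; have := cnorm_ge0 a; have := cnorm_ge0 b; lra.
have near1 h : positive h -> cnorm h <= 1 + cnorm a + cnorm b ->
    cnorm (1 - rscale c h) <= 1.
  move=> hp hn; apply: positive_near1; first exact: positive_rscale (ltW c0) hp.
  rewrite cnorm_rscale gtr0_norm// /c mulrC ler_pdivrMr ?mul1r//.
  by rewrite -invr_gt0.
apply: (@positive_rscaleP (2^-1 * c)).
  by apply: mulr_gt0; rewrite // invr_gt0 ltr0n.
apply: near1_positive.
  by rewrite rscale_star starD !positive_sa.
have -> : 1 - rscale (2^-1 * c) (a + b) =
    rscale 2^-1 ((1 - rscale c a) + (1 - rscale c b)).
  transitivity (rscale 2^-1 ((1 + 1) - rscale c (a + b))).
    by rewrite rscaleBr rscale_half rscaleA.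
  by congr rscale; rewrite rscaleDr; non_commutative_ring.
rewrite cnorm_rscale ger0_norm ?invr_ge0 ?ler0n//.
have := cnormD (1 - rscale c a) (1 - rscale c b).
have a0 := cnorm_ge0 a; have b0 := cnorm_ge0 b.
have : cnorm (1 - rscale c a) <= 1 by apply: near1 => //; lra.
have : cnorm (1 - rscale c b) <= 1 by apply: near1 => //; lra.
lra.
Qed.

Lemma positive_star_mulD y : positive (y * star y + star y * y).
Proof.
apply: (@positive_rscaleP 2); rewrite ?ltr0n//.
pose h := y + star y; pose k := 'i%C *: (y - star y).
have -> : rscale 2 (y * star y + star y * y) = h * h + k * k.
  have -> : 2 = 1 + 1 :> R by lra.
  rewrite rscaleDl rscale1 /k -scalerAl -scalerAr scalerA.
  by rewrite imaginary_sqr scaleN1r /h; non_commutative_ring.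
apply: positiveD; [exists h | exists k]; split=> //.
  by rewrite /h starD starK addrC.
rewrite /k starZ starB starK.
by rewrite conj_imaginary scaleNr -scalerN opprB.
Qed.

(* For [t = s^2] of norm one and [q] a square root of [1 - t] commuting with
   [s], the element [s + i q] is unitary with square [(s^2 - q^2) + 2 i s q],
   so that [s q] has norm at most 1/2. *)
Lemma cnorm_sandwich_le (s : A) : star s = s -> cnorm (s * s) <= 1 ->
  cnorm ((1 - s * s) * (s * s) * (1 - s * s)) <= 4^-1.
Proof.
move=> ss s1.
have [||q [sq q2 _ qc]] := @sqrt_of_near1 (1 - s * s).
- by rewrite starB star1 starM ss.
- by rewrite subKr.
have sqc : s * q = q * s.
  by apply: qc; rewrite mulrBr mulrBl mulr1 mul1r mulrA.
pose b := s * q + s * q; pose a := s * s - q * q.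
have ssq : star (s * q) = s * q by rewrite starM ss sq sqc.
have b1 : cnorm b <= 1.
  have sb : star b = b by rewrite /b starD ssq.
  have sa : star a = a by rewrite /a starB !starM ss sq.
  have ba : b * a = a * b.
    have c1 : GRing.comm (s * q) s by rewrite /GRing.comm -mulrA -sqc.
    have c2 : GRing.comm (s * q) q by rewrite /GRing.comm mulrA -sqc.
    have e : s * q * a = a * (s * q) by apply: commrB; apply: commrM.
    by rewrite /b mulrDl [a * _]mulrDr e.
  have := cnorm_le_sum_squares sb sa ba.
  have -> : b * b + a * a = (s * s + q * q) * (s * s + q * q).
    have e1 : q * q * (s * s) = s * s * (q * q).
      have c : GRing.comm (s * s) q by apply/commr_sym/commrM; exact: esym.
      by apply/esym; apply: commrM.
    have e2 : s * q * (s * q) = s * s * (q * q).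
      by rewrite -!mulrA (mulrA q s q) -sqc !mulrA.
    rewrite /b /a; move: (s * q) (s * s) (q * q) e1 e2 => x p r e1 e2.
    transitivity (x * x + x * x + x * x + x * x
      + (p * p - p * r - r * p + r * r)); first non_commutative_ring.
    transitivity (p * p + p * r + r * p + r * r); last non_commutative_ring.
    by rewrite e2 e1; non_commutative_ring.
  by rewrite q2 addrC subrK mulr1 cnorm1; have := cnorm_ge0 b; nra.
have h2 : cnorm (s * q) <= 2^-1.
  rewrite -[s * q]rscale_half cnorm_rscale -/b ger0_norm ?invr_ge0 ?ler0n//; lra.
have q1 : cnorm (q * q) <= 1.
  rewrite q2; apply: cnorm_1Bsqr_le1 => //.
  by move: s1; rewrite cnorm_sqr_sa//; have := cnorm_ge0 s; nra.
rewrite -q2.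
(* Regrouped by commutation, the product is bounded by 1/2 times 1 times 1/2. *)
have -> : q * q * (s * s) * (q * q) = (s * q) * (q * q) * (s * q).
  transitivity (q * q * (s * s * q) * q); first non_commutative_ring.
  have -> : s * s * q = q * s * s by rewrite -mulrA sqc mulrA sqc.
  transitivity (q * (q * q * s) * (s * q)); first non_commutative_ring.
  have <- : s * (q * q) = q * q * s by rewrite mulrA sqc -mulrA sqc mulrA.
  by rewrite [q * (s * _)]mulrA -sqc.
have := cnormM ((s * q) * (q * q)) (s * q).
have := cnormM (s * q) (q * q).
have := cnorm_ge0 (s * q); have := cnorm_ge0 (q * q).
have := cnorm_ge0 ((s * q) * (q * q)).
set X := cnorm (s * q); set Y := cnorm (q * q); set Z := cnorm (s * q * (q * q)).
move=> *; have : Z <= 2^-1 by rewrite -/X -/Y in h2 q1; nra.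
rewrite -/X in h2; nra.
Qed.

(* If [y^* y = - t] with [t = s^2] of norm one, then
   [y (1 - t) = (1 + y y^* ) y], where the left-hand side has norm at most 1/2
   and, [y y^*] being positive, the right-hand side has norm at least 1. *)
Lemma star_mul_negative_norm1 y s :
  star s = s -> star y * y = - (s * s) -> cnorm y != 1.
Proof.
move=> ss ys; apply/eqP => y1.
have t1 : cnorm (s * s) <= 1.
  by rewrite -cnormN -ys cnorm_star_mul y1 expr1n.
have w_pos : positive (y * star y).
  have -> : y * star y = (y * star y + star y * y) + s * s.
    by rewrite ys subrK.
  by apply: positiveD; [exact: positive_star_mulD | exists s].
have w1 : cnorm (1 - y * star y) <= 1.
  apply: positive_near1 => //.
  by rewrite -[y in y * _]starK cnorm_star_mul cnorm_star y1 expr1n.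
have yk : y * (1 - s * s) = y + y - (1 - y * star y) * y.
  by rewrite mulrBr -mulrN -ys; non_commutative_ring.
have : cnorm (y * (1 - s * s)) ^+ 2 <= 4^-1.
  rewrite -cnorm_star_mul starM starB star1 starM ss -mulrA (mulrA (star y)) ys.
  by rewrite mulNr mulrN cnormN mulrA; exact: cnorm_sandwich_le.
have := cnormD (y * (1 - s * s)) ((1 - y * star y) * y).
have := cnormM (1 - y * star y) y.
rewrite yk subrK -[y + y]rscale_half rscaleDr.
have -> : rscale 2^-1 (y + y) = y by rewrite rscale_half.
have -> : cnorm (y + y) = 2.
  have -> : y + y = rscale (1 + 1) y by rewrite rscaleDl rscale1.
  by rewrite cnorm_rscale y1 mulr1 ger0_norm//; lra.
rewrite y1 mulr1.
have := cnorm_ge0 (y + y - (1 - y * star y) * y).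
move=> X0 m1 d1 q1.
have X1 : 1 <= cnorm (y + y - (1 - y * star y) * y) by move: w1; lra.
by move: X1 q1; clear; move: (cnorm _) => Z *; nra.
Qed.

Lemma star_mul_negative_eq0 y s : star s = s -> star y * y = - (s * s) -> y = 0.
Proof.
move=> ss ys; apply/eqP; apply: contraT => y0.
have c0 : cnorm y != 0 by rewrite gt_eqF// cnorm_gt0.
pose c := (cnorm y)^-1.
have := @star_mul_negative_norm1 (rscale c y) (rscale c s).
rewrite !rscale_star ss !(rscaleMl, rscaleMr) ys /rscale !scalerN => h.
have := h erefl erefl; rewrite -/(rscale c y) cnorm_rscale.
by rewrite ger0_norm ?invr_ge0 ?cnorm_ge0// mulVf// eqxx.
Qed.

(** For [h = y^* y], let [m] be the square root of [h^2] and [n = m - h]. Then [n h n = - n m n] is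
    minus a square, so [y n = 0] by [star_mul_negative_eq0]. Hence [h n = 0] and [m n = 0], so
    [n^2 = 0] and [h = m], which has a square root [q]. *)
Lemma positive_star_mul x : positive (star x * x).
Proof.
suff norm1 y : cnorm y <= 1 -> positive (star y * y).
  have c0 : 0 < 1 + cnorm x by have := cnorm_ge0 x; lra.
  have := norm1 (rscale (1 + cnorm x)^-1 x).
  rewrite rscale_star rscaleMl rscaleMr rscaleA => h.
  apply: (@positive_rscaleP ((1 + cnorm x)^-1 * (1 + cnorm x)^-1)).
    by rewrite mulr_gt0 ?invr_gt0.
  apply: h; rewrite cnorm_rscale gtr0_norm ?invr_gt0//.
  by rewrite mulrC ler_pdivrMr// mul1r; lra.
move=> y1; set h := star y * y.
have sh : star h = h by rewrite /h starM starK.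
have h1 : cnorm h <= 1.
  by rewrite /h cnorm_star_mul; have := cnorm_ge0 y; nra.
have [||m [sm m2 m1 mc]] := @sqrt_of_near1 (h * h).
- by rewrite starM sh.
- exact: cnorm_1Bsqr_le1.
have [q [sq q2 _ qc]] := sqrt_of_near1 sm m1.
have hm : h * m = m * h by apply: mc; rewrite mulrA.
(* [n] is twice the negative part of [h]. *)
pose n := m - h.
have sn : star n = n by rewrite /n starB sm sh.
have mn : n * m = m * n by rewrite /n mulrBl mulrBr hm.
have hn : h * n = - (m * n).
  by rewrite /n !mulrBr m2 hm; non_commutative_ring.
have nq : n * q = q * n by rewrite qc.
have yn0 : y * n = 0.
  apply: (@star_mul_negative_eq0 _ (n * q)); first by rewrite starM sn sq nq.
  transitivity (n * (h * n)).
    by rewrite starM sn; clearbody n; rewrite /h; non_commutative_ring.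
  rewrite hn mulrN; congr (- _); transitivity (n * q * (q * n)); last by rewrite -nq.
  by rewrite -q2 !mulrA.
have n0 : n = 0.
  apply: cnorm_eq0; apply/eqP; rewrite -sqrf_eq0 -cnorm_sqr_sa//.
  have hn0 : h * n = 0 by rewrite /h -mulrA yn0 mulr0.
  have -> : n * n = m * n - h * n by rewrite -mulrBl.
  by rewrite -[m * n]opprK -hn hn0 subr0 oppr0 cnorm0.
by have := subr0_eq n0 => <-; exists q; rewrite q2.
Qed.

Lemma positive_conj x h : positive h -> positive (star x * h * x).
Proof.
move=> [s [ss ->]].
rewrite (_ : _ * _ = star (s * x) * (s * x)); first exact: positive_star_mul.
by rewrite starM ss !mulrA.
Qed.

Lemma positive_bound c h : star h = h -> cnorm h <= c -> positive (rscale c 1 - h).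
Proof.
move=> sh hc.
have [c0|c0] := leP c 0.
  have -> : h = 0.
    by apply: cnorm_eq0; apply/eqP; rewrite eq_le cnorm_ge0 (le_trans hc c0).
  have -> : c = 0 by apply/eqP; rewrite eq_le c0 (le_trans (cnorm_ge0 h) hc).
  by exists 0; rewrite star0 mulr0 subr0 /rscale rmorph0 scale0r.
apply: (@positive_rscaleP c^-1); first by rewrite invr_gt0.
have -> : rscale c^-1 (rscale c 1 - h) = 1 - rscale c^-1 h.
  by rewrite rscaleBr rscaleA mulVf ?gt_eqF// rscale1.
apply: near1_positive; first by rewrite starB star1 rscale_star sh.
rewrite subKr cnorm_rscale gtr0_norm ?invr_gt0//.
by rewrite mulrC ler_pdivrMr// mul1r.
Qed.

(** With [h = s^2] and [c - h = v^2] for commuting [s] and [v], [cnorm_le_sum_squares] gives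
    [|h| = |s|^2 <= |s^2 + v^2| = c]. *)
Lemma cnorm_le_positive c h : 0 <= c -> positive h -> positive (rscale c 1 - h) ->
  cnorm h <= c.
Proof.
move=> c0 [s [ss hs]] /positive_sqrt[v [sv v2 vc]].
have sv_comm : s * v = v * s.
  apply: vc; rewrite mulrBr mulrBl rscaleMr rscaleMl mulr1 mul1r hs.
  by rewrite mulrA.
have := cnorm_le_sum_squares ss sv sv_comm.
by rewrite v2 -hs addrC subrK hs cnorm_sqr_sa// cnorm_rscale cnorm1 mulr1 ger0_norm.
Qed.

Lemma cnorm_positiveD a b : positive a -> positive b -> cnorm a <= cnorm (a + b).
Proof.
move=> ap bp; apply: cnorm_le_positive => //; first exact: cnorm_ge0.
have -> : rscale (cnorm (a + b)) 1 - a =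
    (rscale (cnorm (a + b)) 1 - (a + b)) + b by non_commutative_ring.
apply: positiveD => //; apply: positive_bound => //.
exact/positive_sa/positiveD.
Qed.

End Positivity.

(** * The C*-norm of [mat2 A] *)

Lemma ord2P (i : 'I_2) : i = 0 \/ i = 1.
Proof.
by case: i => [[|[|//]] hi]; [left | right]; apply: val_inj.
Qed.

Lemma mat2P (A : Type) (X Y : mat2 A) : X 0 0 = Y 0 0 -> X 0 1 = Y 0 1 ->
  X 1 0 = Y 1 0 -> X 1 1 = Y 1 1 -> X = Y.
Proof.
move=> *; apply/matrixP => i j.
by case: (ord2P i) => ->; case: (ord2P j) => ->.
Qed.

Lemma mat2_mulE (A : nzRingType) (X Y : mat2 A) i j :
  (X * Y) i j = X i 0 * Y 0 j + X i 1 * Y 1 j.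
Proof.
rewrite mxE !big_ord_recl big_ord0 addr0.
by rewrite (_ : lift ord0 ord0 = 1)//; apply: val_inj.
Qed.

Lemma mat2_scaleE (K : numClosedFieldType) (A : starAlgType K) (a : K)
  (X : mat2 A) i j : (a *: X) i j = a *: X i j.
Proof. by rewrite mxE. Qed.

Lemma mat2_starE (K : numClosedFieldType) (A : starAlgType K)
  (X : mat2 A) i j : star X i j = star (X j i).
Proof. by rewrite mxE. Qed.

(* The first column of [X : mat2 A] is regarded as a vector of the right Hilbert
   [A]-module [A^2], on which [mat2 A] acts by left multiplication. *)
Section HilbertModule.
Variables (R : realType) (A : cstarAlgType R).
Implicit Types (X Y Z T : mat2 A) (a b : A) (c : R).

Definition inner X Y : A := (star X * Y) 0 0.

Lemma innerE X Y : inner X Y = star (X 0 0) * Y 0 0 + star (X 1 0) * Y 1 0.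
Proof. by rewrite /inner mat2_mulE !mat2_starE. Qed.

Lemma inner_star X Y : star (inner X Y) = inner Y X.
Proof. by rewrite /inner -mat2_starE starM starK. Qed.

Lemma innerDr X Y Z : inner X (Y + Z) = inner X Y + inner X Z.
Proof. by rewrite /inner mulrDr mxE. Qed.

Lemma innerBr X Y Z : inner X (Y - Z) = inner X Y - inner X Z.
Proof. by rewrite /inner mulrBr !mxE. Qed.

Lemma innerDl X Y Z : inner (Y + Z) X = inner Y X + inner Z X.
Proof. by rewrite -inner_star innerDr starD !inner_star. Qed.

Lemma innerBl X Y Z : inner (Y - Z) X = inner Y X - inner Z X.
Proof. by rewrite -inner_star innerBr starB !inner_star. Qed.

Lemma innerZr (k : R[i]) X Y : inner X (k *: Y) = k *: inner X Y.
Proof. by rewrite /inner -scalerAr mat2_scaleE. Qed.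

Lemma innerZl (k : R[i]) X Y : inner (k *: X) Y = Num.conj k *: inner X Y.
Proof. by rewrite -inner_star innerZr starZ inner_star. Qed.

Lemma innerMr a X Y : inner X (Y * mx22 a 0 0 a) = inner X Y * a.
Proof. by rewrite /inner mulrA mat2_mulE !mxE /= mulr0 addr0. Qed.

Lemma innerMl a X Y : inner (X * mx22 a 0 0 a) Y = star a * inner X Y.
Proof. by rewrite -inner_star innerMr starM inner_star. Qed.

Lemma inner_adjoint T X Y : inner (T * X) Y = inner X (star T * Y).
Proof. by rewrite /inner starM mulrA. Qed.

Lemma inner_positive X : positive (inner X X).
Proof. by rewrite innerE; apply: positiveD; exact: positive_star_mul. Qed.

Definition vnorm X : R := Num.sqrt (cnorm (inner X X)).

Lemma vnorm_ge0 X : 0 <= vnorm X. Proof. exact: sqrtr_ge0. Qed.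

Lemma vnorm_sqr X : vnorm X ^+ 2 = cnorm (inner X X).
Proof. by rewrite sqr_sqrtr ?cnorm_ge0. Qed.

(** [<X, X>] dominates the square of each entry, since the other summand is positive. *)
Lemma cnorm_le_vnorm X i : cnorm (X i 0) <= vnorm X.
Proof.
rewrite -ler_sqr ?nnegrE ?cnorm_ge0 ?vnorm_ge0// vnorm_sqr -cnorm_star_mul innerE.
case: (ord2P i) => ->; first by apply: cnorm_positiveD; exact: positive_star_mul.
by rewrite addrC; apply: cnorm_positiveD; exact: positive_star_mul.
Qed.

Lemma vnorm_le X : vnorm X <= cnorm (X 0 0) + cnorm (X 1 0).
Proof.
have h0 := cnorm_ge0 (X 0 0); have h1 := cnorm_ge0 (X 1 0).
rewrite -ler_sqr ?nnegrE ?addr_ge0 ?vnorm_ge0// vnorm_sqr innerE.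
by apply: (le_trans (cnormD _ _)); rewrite !cnorm_star_mul; nra.
Qed.

(* The inner square of [m X - Y a], with [m = |<Y, Y>|] and [a = <Y, X>]. *)
Lemma cauchy_schwarz X Y : cnorm (inner Y X) <= vnorm Y * vnorm X.
Proof.
pose m := cnorm (inner Y Y); pose a := inner Y X.
have m_ge0 : 0 <= m by exact: cnorm_ge0.
have key : m * cnorm a ^+ 2 <= m ^+ 2 * cnorm (inner X X).
  (* Adding the positive elements [a^* (m - <Y, Y>) a] and [m a^* a] to this inner square leaves
     exactly [m^2 <X, X>], whose norm therefore bounds that of [m a^* a]. *)
  have := inner_positive (m%:C%C *: X - Y * mx22 a 0 0 a).
  have := positive_conj a (positive_bound (inner_star Y Y) (lexx m)).
  move=> /positiveD/[apply].
  have := positive_rscale m_ge0 (positive_star_mul a).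
  move=> /cnorm_positiveD/[apply].
  rewrite cnorm_rscale cnorm_star_mul ger0_norm//.
  move=> /le_trans; apply.
  rewrite (_ : _ + _ = rscale (m ^+ 2) (inner X X)).
    by rewrite cnorm_rscale ger0_norm ?sqr_ge0.
  rewrite innerBr !innerBl innerMr innerMl !innerZr !innerZl innerMl innerMr conj_real.
  rewrite -!/(rscale _ _) rscaleA -expr2 -/a -(inner_star Y X) -/a.
  rewrite mulrBr mulrBl rscaleMr mulr1 !rscaleMl (rscaleMr m (star a) a).
  rewrite [star a * (_ * a)]mulrA.
  by non_commutative_ring.
rewrite -ler_sqr ?nnegrE ?mulr_ge0 ?cnorm_ge0 ?vnorm_ge0// exprMn !vnorm_sqr -/m -/a.
(* The factor [m] cancels unless it is 0, in which case the vector [Y] vanishes. *)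
have [m0|m0] := eqVneq m 0; last first.
  have {}m0 : 0 < m by rewrite lt_neqAle eq_sym m0.
  by rewrite -(ler_pM2l m0) [leRHS]mulrA -expr2.
have Y0 i : Y i 0 = 0.
  apply: cnorm_eq0; apply/eqP; rewrite eq_le cnorm_ge0 andbT.
  by apply: (le_trans (cnorm_le_vnorm Y i)); rewrite /vnorm -/m m0 sqrtr0.
by rewrite /a innerE !Y0 star0 !mul0r addr0 cnorm0 m0 mul0r expr0n.
Qed.

Lemma vnormD X Y : vnorm (X + Y) <= vnorm X + vnorm Y.
Proof.
have h0 := vnorm_ge0 X; have h1 := vnorm_ge0 Y.
rewrite -ler_sqr ?nnegrE ?addr_ge0 ?vnorm_ge0// vnorm_sqr innerDr !innerDl.
apply: (le_trans (cnormD _ _)).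
have := cnormD (inner X X) (inner Y X); have := cnormD (inner X Y) (inner Y Y).
have := cauchy_schwarz X Y; have := cauchy_schwarz Y X.
rewrite -!vnorm_sqr; nra.
Qed.

Lemma normc_ge0 (k : R[i]) : 0 <= normc k.
Proof. by case: k => x y; rewrite /= sqrtr_ge0. Qed.

Lemma normc_conj (k : R[i]) : normc (Num.conj k) = normc k.
Proof. by case: k => x y; rewrite /= sqrrN. Qed.

Lemma vnormZ (k : R[i]) X : vnorm (k *: X) = normc k * vnorm X.
Proof.
rewrite /vnorm innerZr innerZl !cnormZ normc_conj mulrA -expr2.
by rewrite sqrtrM ?sqr_ge0// sqrtr_sqr ger0_norm ?normc_ge0.
Qed.

(** A crude upper bound for [op_norm]: it makes the supremum finite and turns entrywise limits into
    limits in [op_norm]. *)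
Definition entry_sum T : R :=
  cnorm (T 0 0) + cnorm (T 0 1) + cnorm (T 1 0) + cnorm (T 1 1).

Lemma vnormM_entry_sum T X : vnorm (T * X) <= entry_sum T * vnorm X.
Proof.
apply: (le_trans (vnorm_le _)); rewrite !mat2_mulE.
have le i : cnorm (T i 0 * X 0 0 + T i 1 * X 1 0) <=
    cnorm (T i 0) * vnorm X + cnorm (T i 1) * vnorm X.
  apply: (le_trans (cnormD _ _)); apply: lerD; apply: (le_trans (cnormM _ _));
  by apply: ler_wpM2l; rewrite ?cnorm_ge0 ?cnorm_le_vnorm.
by have := le 0; have := le 1; rewrite /entry_sum; lra.
Qed.

Lemma entry_sum_ge0 T : 0 <= entry_sum T.
Proof. by rewrite /entry_sum !addr_ge0 ?cnorm_ge0. Qed.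

Definition op_norm T : R := sup [set vnorm (T * X) | X in [set X | vnorm X <= 1]].

Lemma has_sup_op_norm T : has_sup [set vnorm (T * X) | X in [set X | vnorm X <= 1]].
Proof.
split.
  exists (vnorm (T * 0)); exists 0 => //=.
  by rewrite /vnorm innerE !mxE star0 mul0r addr0 cnorm0 sqrtr0 ler01.
exists (entry_sum T) => _ [X /= X1 <-]; apply: (le_trans (vnormM_entry_sum _ _)).
by have := entry_sum_ge0 T; nra.
Qed.

Lemma op_norm_le T c : (forall X, vnorm X <= 1 -> vnorm (T * X) <= c) -> op_norm T <= c.
Proof.
move=> h; apply: ge_sup; first by case: (has_sup_op_norm T).
by move=> _ [X /= X1 <-]; exact: h.
Qed.

Lemma op_norm_ge0 T : 0 <= op_norm T.
Proof.
have [[_ [X X1 _]] bT] := has_sup_op_norm T.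
by apply: le_trans (vnorm_ge0 (T * X)) _; apply: ub_le_sup => //; exists X.
Qed.

Lemma vnormM_op_norm T X : vnorm (T * X) <= op_norm T * vnorm X.
Proof.
(* [X] cannot be normalised when [vnorm X = 0]; the entrywise bound settles that case. *)
have [X0|X0] := eqVneq (vnorm X) 0.
  by have := vnormM_entry_sum T X; rewrite X0 !mulr0.
have {}X0 : 0 < vnorm X by rewrite lt_neqAle eq_sym X0 vnorm_ge0.
have := ub_le_sup (has_sup_op_norm T).2.
move=> /(_ (vnorm (T * ((vnorm X)^-1%:C%C *: X)))).
rewrite -/(op_norm T) -scalerAr vnormZ normc_real ger0_norm ?invr_ge0 ?vnorm_ge0//.
rewrite mulrC ler_pdivrMr//; apply.
exists ((vnorm X)^-1%:C%C *: X) => /=.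
  by rewrite vnormZ normc_real ger0_norm ?invr_ge0 ?vnorm_ge0// mulVf ?gt_eqF.
by rewrite -scalerAr vnormZ normc_real ger0_norm ?invr_ge0 ?vnorm_ge0// mulrC.
Qed.

Lemma op_norm_le_entry_sum T : op_norm T <= entry_sum T.
Proof.
apply: op_norm_le => X X1; apply: (le_trans (vnormM_entry_sum _ _)).
by have := entry_sum_ge0 T; nra.
Qed.

Lemma entry_le_op_norm T i j : cnorm (T i j) <= op_norm T.
Proof.
(* Both columns of [E] are the [j]-th basis vector, which [T] maps to its [j]-th column. *)
pose E : mat2 A := \matrix_(k, l) ((k == j)%:R).
have E1 : vnorm E <= 1.
  apply: (le_trans (vnorm_le _)); rewrite !mxE.
  by case: (ord2P j) => ->; rewrite /= cnorm0 cnorm1 ?addr0 ?add0r.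
have -> : T i j = (T * E) i 0.
  rewrite mat2_mulE !mxE.
  by case: (ord2P j) => ->; rewrite /= mulr0 mulr1 ?addr0 ?add0r.
apply: (le_trans (cnorm_le_vnorm _ _)); apply: (le_trans (vnormM_op_norm _ _)).
by have := op_norm_ge0 T; nra.
Qed.

Lemma op_norm_eq0 T : op_norm T = 0 -> T = 0.
Proof.
move=> T0; have h i j : T i j = 0.
  by apply: cnorm_eq0; apply/eqP; rewrite eq_le cnorm_ge0 -T0 entry_le_op_norm.
by apply/matrixP => i j; rewrite h mxE.
Qed.

Lemma op_normD S T : op_norm (S + T) <= op_norm S + op_norm T.
Proof.
apply: op_norm_le => X X1; rewrite mulrDl; apply: (le_trans (vnormD _ _)).
have := vnormM_op_norm S X; have := vnormM_op_norm T X.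
have := op_norm_ge0 S; have := op_norm_ge0 T; nra.
Qed.

Lemma op_normM S T : op_norm (S * T) <= op_norm S * op_norm T.
Proof.
apply: op_norm_le => X X1; rewrite -mulrA.
have := vnormM_op_norm S (T * X); have := vnormM_op_norm T X.
have := op_norm_ge0 S; have := op_norm_ge0 T => t0 s0 h1 h2.
apply: (le_trans h2); apply: ler_wpM2l => //; apply: (le_trans h1).
by rewrite -[leRHS]mulr1; apply: ler_wpM2l.
Qed.

Lemma op_normZ (k : R[i]) T : op_norm (k *: T) = normc k * op_norm T.
Proof.
have le (l : R[i]) S : op_norm (l *: S) <= normc l * op_norm S.
  apply: op_norm_le => X X1; rewrite -scalerAl vnormZ.
  apply: ler_wpM2l; first exact: normc_ge0.
  have := vnormM_op_norm S X; have := op_norm_ge0 S; nra.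
apply/eqP; rewrite eq_le le /=.
have [->|k0] := eqVneq k 0.
  by rewrite normc0 mul0r op_norm_ge0.
have := le k^-1 (k *: T); rewrite scalerA mulVf// scale1r.
have n0 : 0 < normc k.
  rewrite lt_neqAle eq_sym normc_ge0 andbT.
  by apply: contra_neq k0; exact: eq0_normc.
rewrite -(ler_pM2l n0) mulrA -normcM divff//.
by rewrite normc1 mul1r.
Qed.

(** Cauchy-Schwarz for [|T X|^2 = |<X, T^* T X>|] gives [|T|^2 <= |T^* T| <= |T^*| |T|]. So
    [|T| <= |T^*|], and the same for [T^*] yields equality throughout. *)
Lemma op_norm_star_mul T : op_norm (star T * T) = op_norm T ^+ 2.
Proof.
have le S : op_norm S ^+ 2 <= op_norm (star S * S).
  rewrite -[leRHS]sqr_sqrtr ?op_norm_ge0//.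
  rewrite ler_sqr ?nnegrE ?op_norm_ge0 ?sqrtr_ge0//.
  apply: op_norm_le => X X1.
  rewrite -ler_sqr ?nnegrE ?vnorm_ge0 ?sqrtr_ge0// vnorm_sqr.
  rewrite sqr_sqrtr ?op_norm_ge0// inner_adjoint mulrA.
  apply: (le_trans (cauchy_schwarz _ _)).
  have := vnormM_op_norm (star S * S) X; have := op_norm_ge0 (star S * S).
  have := vnorm_ge0 (star S * S * X); have := vnorm_ge0 X.
  move=> x0 y0 s0 h; apply: (@le_trans _ _ (1 * (op_norm (star S * S) * 1))).
    apply: ler_pM => //; apply: (le_trans h); exact: ler_wpM2l.
  by rewrite mul1r mulr1.
have le_star S : op_norm S <= op_norm (star S).
  have := le_trans (le S) (op_normM _ _).
  have := op_norm_ge0 S; have := op_norm_ge0 (star S); nra.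
apply/eqP; rewrite eq_le le andbT; apply: (le_trans (op_normM _ _)).
have := le_star (star T); rewrite starK expr2; have := op_norm_ge0 T; nra.
Qed.

(** Entries are bounded by [op_norm], hence Cauchy; [entry_sum] bounds the distance to the matrix of
    their limits. *)
Lemma op_norm_complete (s : nat -> mat2 A) :
  (forall e : R, 0 < e -> exists N : nat, forall m n : nat,
      (N <= m)%N -> (N <= n)%N -> op_norm (s m - s n) < e) ->
  exists l : mat2 A, (fun n => op_norm (s n - l)) @ \oo --> (0 : R).
Proof.
move=> cs.
have ex i j : exists l : A, (fun n => cnorm (s n i j - l)) @ \oo --> (0 : R).
  apply: cnorm_complete => e /cs[N hN]; exists N => m n Nm Nn.
  apply: le_lt_trans (hN _ _ Nm Nn).
  by have := entry_le_op_norm (s m - s n) i j; rewrite !mxE.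
have [[a ha] [b hb]] := (ex 0 0, ex 0 1); have [[c hc] [d hd]] := (ex 1 0, ex 1 1).
exists (mx22 a b c d).
apply: (@squeeze_cvgr _ _ _ _ (fun=> 0) (fun n => entry_sum (s n - mx22 a b c d))).
- by near=> n; rewrite op_norm_ge0 op_norm_le_entry_sum.
- exact: cvg_cst.
- have -> : (fun n => entry_sum (s n - mx22 a b c d)) = (fun n =>
      cnorm (s n 0 0 - a) + cnorm (s n 0 1 - b) + cnorm (s n 1 0 - c)
      + cnorm (s n 1 1 - d)).
    by apply/funext => n; rewrite /entry_sum !mxE.
  have -> : (0 : R) = 0 + 0 + 0 + 0 by rewrite !addr0.
  by do 3?[apply: cvgD].
Unshelve. all: by end_near. Qed.

HB.instance Definition _ := isCStarAlgebra.Build R (mat2 A)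
  op_norm_eq0 op_normD op_normZ op_normM op_norm_star_mul op_norm_complete.

End HilbertModule.

(** * The isomorphism *)

Section StarHomTheory.
Variable K : numClosedFieldType.

Lemma starhom_exists (A D : starAlgType K) (f : A -> D) :
    {morph f : x y / x - y} -> f 1 = 1 -> {morph f : x y / x * y} ->
    (forall a, {morph f : x / a *: x}) -> (forall x, f (star x) = star (f x)) ->
  exists h : {starhom A -> D}, h =1 f.
Proof.
move=> fB f1 fM fZ fS.
pose h : {starhom A -> D} := HB.pack f
  (GRing.isZmodMorphism.Build A D f fB)
  (GRing.isMonoidMorphism.Build A D f (conj f1 fM))
  (GRing.isScalable.Build K A D *:%R f fZ)
  (isStarMorphism.Build K A D f fS).
by exists h.
Qed.

Lemma starhom_comp (A B D : starAlgType K) (g : {starhom B -> D})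
  (f : {starhom A -> B}) : exists h : {starhom A -> D}, h =1 g \o f.
Proof.
apply: starhom_exists => [x y||x y|a x|x] /=.
- by rewrite !rmorphB.
- by rewrite !rmorph1.
- by rewrite !rmorphM.
- by rewrite !linearZ.
- by rewrite !star_morph.
Qed.

Lemma unitary_conj (A D : starAlgType K) (f : {starhom A -> D}) (w : D) :
  unitary w -> exists h : {starhom A -> D}, forall x, h x = w * f x * star w.
Proof.
move=> [ww ww']; apply: (@starhom_exists _ _ (fun x => w * f x * star w)).
- by move=> x y; rewrite rmorphB mulrBr mulrBl.
- by rewrite rmorph1 mulr1.
- by move=> x y; rewrite rmorphM !mulrA -[_ * star w * w]mulrA ww' mulr1.
- by move=> a x; rewrite linearZ -scalerAr -scalerAl.
- by move=> x; rewrite !starM starK star_morph mulrA.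
Qed.

Lemma unitary_image (A D : starAlgType K) (f : {starhom A -> D}) (w : A) :
  unitary w -> unitary (f w).
Proof. by move=> [h1 h2]; split; rewrite -star_morph -rmorphM ?h1 ?h2 rmorph1. Qed.

Lemma hnn_relations_image (B C A D : starAlgType K)
    (incl theta : {starhom C -> B}) (jB : {starhom B -> A}) (u : A)
    (f : {starhom A -> D}) (pi : {starhom B -> D}) (v : D) :
    pi =1 f \o jB -> f u = v ->
  hnn_relations incl theta jB u -> hnn_relations incl theta pi v.
Proof.
move=> pif <- [uu uc]; split=> [|c]; first exact: unitary_image.
by rewrite !pif /= -star_morph -!rmorphM uc.
Qed.

Lemma mx22M (A : nzRingType) (a b c d a' b' c' d' : A) :
  mx22 a b c d * mx22 a' b' c' d' =
  mx22 (a * a' + b * c') (a * b' + b * d') (c * a' + d * c') (c * b' + d * d').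
Proof. by apply: mat2P; rewrite mat2_mulE !mxE. Qed.

Lemma mx22D (A : nzRingType) (a b c d a' b' c' d' : A) :
  mx22 a b c d + mx22 a' b' c' d' = mx22 (a + a') (b + b') (c + c') (d + d').
Proof. by apply: mat2P; rewrite !mxE. Qed.

Lemma mx22_star (A : starAlgType K) (a b c d : A) :
  star (mx22 a b c d) = mx22 (star a) (star c) (star b) (star d).
Proof. by apply: mat2P; rewrite !mxE. Qed.

Lemma mx22_1 (A : nzRingType) : 1 = mx22 1 0 0 1 :> mat2 A.
Proof. by apply: mat2P; rewrite !mxE. Qed.

Lemma mx22_eta (A : Type) (X : mat2 A) : X = mx22 (X 0 0) (X 0 1) (X 1 0) (X 1 1).
Proof. by apply: mat2P; rewrite !mxE. Qed.

Definition mx22E := (mx22M, mx22D, mulr0, mul0r, mulr1, mul1r, addr0, add0r).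

(** Diagonal matrices and the unit [e12] generate [mat2 A], since [e21] is the adjoint of [e12]. *)
Lemma mat2_hom_ext (A D : starAlgType K) (f g : {starhom mat2 A -> D}) :
    (forall a b, f (mx22 a 0 0 b) = g (mx22 a 0 0 b)) ->
    f (mx22 0 1 0 0) = g (mx22 0 1 0 0) -> f =1 g.
Proof.
move=> fg fg01 X.
have -> : X = mx22 (X 0 0) 0 0 (X 1 1) + mx22 (X 0 1) 0 0 0 * mx22 0 1 0 0
    + mx22 0 0 0 (X 1 0) * star (mx22 0 1 0 0).
  by rewrite mx22_star !star0 star1 !mx22E -mx22_eta.
by rewrite !rmorphD !rmorphM /= !star_morph !fg fg01.
Qed.

Lemma mat2_map (A D : starAlgType K) (f : {starhom A -> D}) :
  exists h : {starhom mat2 A -> mat2 D}, forall a b c d,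
    h (mx22 a b c d) = mx22 (f a) (f b) (f c) (f d).
Proof.
have [||||| h hf] := @starhom_exists (mat2 A) (mat2 D)
    (fun X => mx22 (f (X 0 0)) (f (X 0 1)) (f (X 1 0)) (f (X 1 1))).
- by move=> X Y; apply: mat2P; rewrite !mxE /= rmorphB.
- by apply: mat2P; rewrite !mxE /= ?rmorph1 ?rmorph0.
- by move=> X Y; apply: mat2P; rewrite !mat2_mulE !mxE /= ?mat2_mulE rmorphD !rmorphM.
- by move=> a X; apply: mat2P; rewrite !mxE /= linearZ.
- by move=> X; apply: mat2P; rewrite !mxE /= star_morph.
by exists h => a b c d; rewrite hf !mxE.
Qed.

Lemma scalar_starhom (A : starAlgType K) :
  exists h : {starhom A -> mat2 A}, forall a, h a = mx22 a 0 0 a.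
Proof.
apply: (@starhom_exists _ _ (fun a : A => mx22 a 0 0 a)).
- by move=> x y; apply: mat2P; rewrite !mxE ?subr0.
- by rewrite -mx22_1.
- by move=> x y; rewrite !mx22E.
- by move=> a x; apply: mat2P; rewrite !mxE ?scaler0.
- by move=> x; rewrite mx22_star star0.
Qed.

End StarHomTheory.

(** * Matrix units and their commutant *)

Section MatrixUnits.
Variables (K : numClosedFieldType) (D : starAlgType K) (e : 'I_2 -> 'I_2 -> D).
Hypothesis e_mul : forall i j k l, e i j * e k l = if j == k then e i l else 0.
Hypothesis e_star : forall i j, star (e i j) = e j i.
Hypothesis e_sum : e 0 0 + e 1 1 = 1.
Implicit Types x y : D.

(* Carries the corner [e 0 0 * D * e 0 0] into the commutant of the units. *)
Definition amplify x : D := e 0 0 * x * e 0 0 + e 1 0 * x * e 0 1.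

(** On the corner the inserted [e 0 0] is absorbed, so that [amplify] is multiplicative there. *)
Lemma amplifyM x y : amplify x * amplify y = amplify (x * e 0 0 * y).
Proof.
have e4 i j k l : e i 0 * x * e 0 j * (e k 0 * y * e 0 l) =
    if j == k then e i 0 * (x * e 0 0 * y) * e 0 l else 0.
  transitivity (e i 0 * x * (e 0 j * e k 0) * y * e 0 l).
    by rewrite !mulrA.
  by rewrite e_mul; case: eqP => _; rewrite ?mulr0 ?mul0r// !mulrA.
by rewrite /amplify mulrDl !mulrDr !e4 /= addr0 add0r.
Qed.

Lemma amplify_star x : star (amplify x) = amplify (star x).
Proof. by rewrite /amplify starD !starM !e_star !mulrA. Qed.

Lemma amplify1 : amplify (e 0 0) = 1.
Proof. by rewrite /amplify !e_mul /= ?e_mul /= e_sum. Qed.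

Lemma amplify_comm x k l : amplify x * e k l = e k l * amplify x.
Proof.
rewrite /amplify mulrDl mulrDr -!mulrA !e_mul !mulrA !e_mul.
by case: (ord2P k) => ->; case: (ord2P l) => ->;
  rewrite /= ?mulr0 ?mul0r ?addr0 ?add0r.
Qed.

(** Universal property of the tensor product with 2 by 2 matrices: a map of [A] commuting with a
    system of units extends to [mat2 A]. *)
Lemma mat2_universal (A : starAlgType K) (h : {starhom A -> D}) :
    (forall a i j, h a * e i j = e i j * h a) ->
  exists Psi : {starhom mat2 A -> D}, forall a b c d,
    Psi (mx22 a b c d) = h a * e 0 0 + h b * e 0 1 + h c * e 1 0 + h d * e 1 1.
Proof.
move=> he; have [||||| Psi PsiE] := @starhom_exists _ (mat2 A) D
    (fun X => h (X 0 0) * e 0 0 + h (X 0 1) * e 0 1 + h (X 1 0) * e 1 0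
              + h (X 1 1) * e 1 1).
- by move=> X Y; rewrite !mxE !rmorphB; non_commutative_ring.
- by rewrite !mxE /= !rmorph1 !rmorph0 !mul0r !addr0 !mul1r.
- have e4 a b i j k l : h a * e i j * (h b * e k l) =
      if j == k then h (a * b) * e i l else 0.
    rewrite mulrA -[h a * _ * _]mulrA -he mulrA -rmorphM -mulrA e_mul.
    by case: eqP; rewrite ?mulr0.
  move=> X Y; rewrite !mat2_mulE !rmorphD !(mulrDl, mulrDr) !e4 /=.
  by rewrite !addr0 !add0r; non_commutative_ring.
- by move=> a X; rewrite !mxE !linearZ /= !scalerDr !scalerAl.
- move=> X; rewrite !mxE !star_morph !starD !starM !e_star -!star_morph !he.
  by non_commutative_ring.
by exists Psi => a b c d; rewrite PsiE !mxE.
Qed.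

End MatrixUnits.

(** * Uniqueness of maps out of the universal algebras *)

Section UniversalHNN.
Variables (R : realType) (B C A : cstarAlgType R).
Variables (incl theta : {starhom C -> B}) (jB : {starhom B -> A}) (u : A).
Hypothesis hA : universal_hnn incl theta jB u.

(** The images of the generators under [g] satisfy the HNN relations; [f] and [g] both equal the
    unique map so induced. *)
Lemma universal_hnn_ext (D : cstarAlgType R) (f g : {starhom A -> D}) :
  (forall b, f (jB b) = g (jB b)) -> f u = g u -> f =1 g.
Proof.
move=> fg fgu; have [pi piE] := starhom_comp g jB.
have [|h [_ _ uniq]] := hA.2 D pi (g u).
  exact: hnn_relations_image piE erefl hA.1.
move=> x; transitivity (h x); first by apply: uniq => // b; rewrite piE /= fg.
by apply/esym/uniq => // b; rewrite piE.
Qed.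

(* Conjugation by [w] fixes the generators, hence the image of [h]. *)
Lemma universal_hnn_commutant (D : cstarAlgType R) (h : {starhom A -> D}) (w : D) :
    unitary w -> (forall b, h (jB b) * w = w * h (jB b)) -> h u * w = w * h u ->
  forall a, h a * w = w * h a.
Proof.
move=> uw wb wu a; have [g gE] := unitary_conj h uw.
have gh : g a = h a.
  apply: universal_hnn_ext => [b|]; rewrite gE.
    by rewrite -wb -mulrA uw.1 mulr1.
  by rewrite -wu -mulrA uw.1 mulr1.
by rewrite -{1}gh gE -mulrA uw.2 mulr1.
Qed.

End UniversalHNN.

Lemma universal_amalgam_ext (R : realType) (Q P1 P2 : starAlgType R[i])
    (A D : cstarAlgType R) (i1 : {starhom Q -> P1}) (i2 : {starhom Q -> P2})
    (j1 : {starhom P1 -> A}) (j2 : {starhom P2 -> A}) (f g : {starhom A -> D}) :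
    universal_amalgam i1 i2 j1 j2 -> (forall x, f (j1 x) = g (j1 x)) ->
  (forall y, f (j2 y) = g (j2 y)) -> f =1 g.
Proof.
move=> [j12 univ] fg1 fg2.
have [f1 f1E] := starhom_comp g j1; have [f2 f2E] := starhom_comp g j2.
have [|h [_ _ uniq]] := univ D f1 f2; first by move=> q; rewrite f1E f2E /= j12.
move=> x; transitivity (h x).
  by apply: uniq => y; rewrite ?f1E ?f2E /= ?fg1 ?fg2.
by apply/esym/uniq => y; rewrite ?f1E ?f2E.
Qed.

(** * The maps between the amalgam and the matrices over the HNN extension *)

Section HNNAmalgam.
Variables (R : realType) (B C A AA : cstarAlgType R).
Variables (incl theta : {starhom C -> B}) (jB : {starhom B -> A}) (u : A).
Variables (jtheta : {starhom mat2 B -> AA}) (j1 : {starhom mat2 C -> AA}).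
Hypothesis hA : universal_hnn incl theta jB u.
Hypothesis hAA : universal_amalgam (diag_hom incl theta) (diag_hom idfun idfun)
  jtheta j1.

Lemma amalgam_to_mat2 : exists Phi : {starhom AA -> mat2 A},
  [/\ forall a b c d, Phi (jtheta (mx22 a b c d)) =
        mx22 (jB a) (jB b) (jB c) (jB d)
    & Phi (j1 (mx22 0 1 0 0)) = mx22 0 u 0 0].
Proof.
have [[uu uu'] uc] := hA.1.
have [f1 f1E] := mat2_map jB; have [g gE] := starhom_comp jB incl.
have [f2' f2'E] := mat2_map g.
(* Conjugation by [diag 1 u^*] turns [diag c1 c2] into [diag c1 (theta c2)], as the amalgamation
   requires, and [e12] into [u e12]. *)
have [|f2 f2E] := @unitary_conj _ _ _ f2' (mx22 1 0 0 (star u)).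
  by split; rewrite mx22_star starK !star0 !star1 !mx22E ?uu ?uu' -mx22_1.
have {f2' f2'E g gE} f2E a b c d : f2 (mx22 a b c d) =
    mx22 (jB (incl a)) (jB (incl b) * u) (star u * jB (incl c))
      (star u * jB (incl d) * u).
  by rewrite f2E f2'E mx22_star !star0 !star1 starK !mx22E !gE.
have [q|Phi [Phi1 Phi2 _]] := hAA.2 (mat2 A) f1 f2.
  rewrite /diag_hom f1E f2E /= !rmorph0 mul0r mulr0; congr mx22.
  by rewrite -uc !mulrA uu' mul1r -mulrA uu' mulr1.
exists Phi; split=> [a b c d|]; first by rewrite Phi1 f1E.
by rewrite Phi2 f2E !rmorph0 !rmorph1 mul1r mulr0 mul0r.
Qed.

Let e (i j : 'I_2) : AA := jtheta (delta_mx i j).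

Let eE : (e 0 0 = jtheta (mx22 1 0 0 0)) * (e 0 1 = jtheta (mx22 0 1 0 0)) *
  (e 1 0 = jtheta (mx22 0 0 1 0)) * (e 1 1 = jtheta (mx22 0 0 0 1)).
Proof. by do !split; congr (jtheta _); apply: mat2P; rewrite !mxE. Qed.

Let e_mul i j k l : e i j * e k l = if j == k then e i l else 0.
Proof.
rewrite /e -rmorphM.
have -> : (delta_mx i j : mat2 B) * delta_mx k l = delta_mx i l *+ (j == k).
  exact: mul_delta_mx_cond.
by case: (j == k); rewrite ?mulr1n// mulr0n rmorph0.
Qed.

Let e_star i j : star (e i j) = e j i.
Proof.
rewrite /e -star_morph; congr (jtheta _); apply/matrixP => k l; rewrite !mxE andbC.
by case: andb; rewrite ?star1 ?star0.
Qed.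

Let e_sum : e 0 0 + e 1 1 = 1.
Proof. by rewrite !eE -rmorphD !mx22E -mx22_1 rmorph1. Qed.

Let jdiag c d : jtheta (mx22 (incl c) 0 0 (theta d)) = j1 (mx22 c 0 0 d).
Proof. exact: hAA.1 (c, d). Qed.

Let V : AA := j1 (mx22 0 1 0 0) * jtheta (mx22 0 0 1 0).

Let V_star : star V = jtheta (mx22 0 1 0 0) * j1 (mx22 0 0 1 0).
Proof. by rewrite /V starM -!star_morph !mx22_star !star0 !star1. Qed.

(** [jtheta e21] moves [theta c] to the lower corner, where amalgamation identifies it with [c] in
    [mat2 C]; [j1 e12] moves it back up. *)
Let V_conj c : V * jtheta (mx22 (theta c) 0 0 0) * star V =
  jtheta (mx22 (incl c) 0 0 0).
Proof.
have := jdiag c 0; rewrite rmorph0 => ->.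
have := jdiag 0 c; rewrite rmorph0 => jc.
transitivity (j1 (mx22 0 1 0 0) * (jtheta (mx22 0 0 1 0)
    * jtheta (mx22 (theta c) 0 0 0) * jtheta (mx22 0 1 0 0)) * j1 (mx22 0 0 1 0)).
  by rewrite V_star !mulrA.
by rewrite -!rmorphM !mx22E /= jc -!rmorphM !mx22E.
Qed.

(** One half of unitarity in the corner; the other half is [V_conj] at [c = 1]. *)
Let V_star_conj : star V * e 0 0 * V = e 0 0.
Proof.
have := jdiag 1 0; rewrite rmorph0 rmorph1 => j11.
have := jdiag 0 1; rewrite rmorph0 rmorph1 => j22.
transitivity (jtheta (mx22 0 1 0 0) * (j1 (mx22 0 0 1 0) * e 0 0
    * j1 (mx22 0 1 0 0)) * jtheta (mx22 0 0 1 0)).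
  by rewrite V_star !mulrA.
by rewrite eE j11 -!rmorphM !mx22E /= -j22 -!rmorphM !mx22E.
Qed.

Let amplify_jtheta b :
  amplify e (jtheta (mx22 b 0 0 0)) = jtheta (mx22 b 0 0 b).
Proof. by rewrite /amplify !eE -!rmorphM -rmorphD !mx22E. Qed.

Let hnn_in_amalgam (pi : {starhom B -> AA}) :
  (forall b, pi b = jtheta (mx22 b 0 0 b)) ->
  hnn_relations incl theta pi (amplify e V).
Proof.
move=> piE; have e00 b : e 0 0 * jtheta (mx22 b 0 0 0) = jtheta (mx22 b 0 0 0).
  by rewrite eE -rmorphM !mx22E.
have e00' b : jtheta (mx22 b 0 0 0) * e 0 0 = jtheta (mx22 b 0 0 0).
  by rewrite eE -rmorphM !mx22E.
split=> [|c]; first split.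
- rewrite amplify_star// amplifyM// eE -(rmorph1 theta) V_conj rmorph1 -eE.
  exact: amplify1.
- by rewrite amplify_star// amplifyM// V_star_conj amplify1.
- rewrite !piE -!amplify_jtheta amplify_star// !amplifyM//.
  by rewrite -(mulrA V) e00 -(mulrA V _ (e 0 0)) e00' V_conj.
Qed.

(** Lets the inverse map recover [j1 e12] from [u e12]. It holds because [jtheta] and [j1] agree on
    the diagonal units. *)
Let amplify_V_e01 : amplify e V * e 0 1 = j1 (mx22 0 1 0 0).
Proof.
have := jdiag 1 0; rewrite rmorph0 rmorph1 => j11.
have := jdiag 0 1; rewrite rmorph0 rmorph1 => j22.
rewrite /amplify mulrDl -!mulrA !e_mul /= !mulr0 addr0 /V.
rewrite -?mulrA -eE.1.2 e_mul /= !eE j11 j22.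
by rewrite -!rmorphM !mx22E.
Qed.

Lemma amalgam_from_mat2 : exists (h : {starhom A -> AA}) (Psi : {starhom mat2 A -> AA}),
  [/\ forall b, h (jB b) = jtheta (mx22 b 0 0 b),
      h u = jtheta (mx22 1 0 0 0) * V * jtheta (mx22 1 0 0 0)
        + jtheta (mx22 0 0 1 0) * V * jtheta (mx22 0 1 0 0),
      h u * jtheta (mx22 0 1 0 0) = j1 (mx22 0 1 0 0)
    & forall a b c d, Psi (mx22 a b c d) =
        h a * jtheta (mx22 1 0 0 0) + h b * jtheta (mx22 0 1 0 0)
        + h c * jtheta (mx22 0 0 1 0) + h d * jtheta (mx22 0 0 0 1)].
Proof.
have [sc scE] := scalar_starhom B; have [pi piE] := starhom_comp jtheta sc.
have {sc scE}piE b : pi b = jtheta (mx22 b 0 0 b) by rewrite piE /= scE.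
have [h [hB hu _]] := hA.2 AA pi (amplify e V) (hnn_in_amalgam piE).
have hBE b k l : h (jB b) * e k l = e k l * h (jB b).
  by rewrite hB piE -amplify_jtheta amplify_comm.
have huE k l : h u * e k l = e k l * h u by rewrite hu amplify_comm.
(* The flip and [diag 1 (-1)] are unitaries that generate all units: [e 0 0 = (1 + d) / 2], and the
   others arise by multiplying it by [s] on either side. *)
pose s := e 0 1 + e 1 0; pose d := e 0 0 - e 1 1.
have us : unitary s.
  by split; rewrite /s starD !e_star !(mulrDl, mulrDr) !e_mul /=
    ?(addr0, add0r) ?(addrC (e 1 1)) e_sum.
have ud : unitary d.
  by split; rewrite /d starB !e_star !(mulrBl, mulrBr) !e_mul /= !subr0 !sub0r opprK e_sum.
have hs a : h a * s = s * h a.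
  by apply: (universal_hnn_commutant hA) => // [b|]; rewrite /s mulrDl mulrDr ?hBE ?huE.
have hd a : h a * d = d * h a.
  by apply: (universal_hnn_commutant hA) => // [b|]; rewrite /d mulrBl mulrBr ?hBE ?huE.
have h00 a : GRing.comm (h a) (e 0 0).
  have -> : e 0 0 = rscale 2^-1 (1 + d).
    by rewrite -e_sum /d addrACA subrr addr0 rscale_half.
  by rewrite /GRing.comm rscaleMl rscaleMr mulrDl mulrDr hd mulr1 mul1r.
have he a k l : h a * e k l = e k l * h a.
  suff : GRing.comm (h a) (e k l) by [].
  have -> : e k l = (if k == 0 then 1 else s) * e 0 0 * (if l == 0 then 1 else s).
    rewrite /s; case: (ord2P k) => ->; case: (ord2P l) => ->;
    by rewrite /= ?(mul1r, mulr1) ?(mulrDl, mulrDr) ?e_mul /=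
      ?(mul0r, addr0, add0r) ?e_mul /= ?(addr0, add0r).
  have hs' (b : bool) : GRing.comm (h a) (if b then 1 else s).
    by case: b; [exact: commr1 | exact: hs].
  by do 2?apply: commrM => //.
have [Psi PsiE] := mat2_universal e_mul e_star e_sum he.
exists h, Psi; split=> [b|||a' b' c' d']; first by rewrite hB piE.
- by rewrite hu /amplify !eE.
- by rewrite hu -eE amplify_V_e01.
- by rewrite PsiE !eE.
Qed.

End HNNAmalgam.

Theorem proposition2p4 (R : realType) (B C : cstarAlgType R)
    (incl theta : {starhom C -> B})
    (incl_inj : injective incl) (theta_inj : injective theta)
    (A : cstarAlgType R) (jB : {starhom B -> A}) (u : A)
    (hA : universal_hnn incl theta jB u)
    (AA : cstarAlgType R)
    (jtheta : {starhom mat2 B -> AA}) (j1 : {starhom mat2 C -> AA})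
    (hAA : universal_amalgam (diag_hom incl theta) (diag_hom idfun idfun)
             jtheta j1) :
  exists Phi : {starhom AA -> mat2 A},
    [/\ bijective Phi,
        Phi (j1 (mx22 0 1 0 0) * jtheta (mx22 0 0 1 0)) = mx22 u 0 0 0,
        forall b : B, Phi (jtheta (mx22 b 0 0 0)) = mx22 (jB b) 0 0 0
      & Phi (jtheta (mx22 0 1 0 0)) = mx22 0 1 0 0].
Proof.
have [Phi [Phi_theta Phi_1]] := amalgam_to_mat2 hA hAA.
have [h [Psi [hB hu hu01 PsiE]]] := amalgam_from_mat2 hA hAA.
have Phi_V : Phi (j1 (mx22 0 1 0 0) * jtheta (mx22 0 0 1 0)) = mx22 u 0 0 0.
  by rewrite rmorphM /= Phi_1 Phi_theta !rmorph0 rmorph1 !mx22E.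
(* Both sides are *-homomorphisms in [a], so it suffices to compare them on [jB b] and [u]. *)
have Phi_h a : Phi (h a) = mx22 a 0 0 a.
  have [sc scE] := scalar_starhom A; have [g gE] := starhom_comp Phi h.
  suff gsc : g =1 sc by rewrite -scE -gsc gE.
  apply: (universal_hnn_ext hA) => [b|].
    by rewrite gE /= hB Phi_theta scE !rmorph0.
  rewrite gE /= hu scE rmorphD !rmorphM -rmorphM /= Phi_V !Phi_theta.
  by rewrite !rmorph0 !rmorph1 !mx22E.
have PsiK : cancel Psi Phi.
  move=> T; rewrite [in LHS](mx22_eta T) PsiE !rmorphD !rmorphM /= !Phi_h !Phi_theta.
  by rewrite !rmorph0 !rmorph1 !mx22E -mx22_eta.
have PhiK : cancel Phi Psi.
  have [g gE] := starhom_comp Psi Phi.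
  have Psi_theta X : Psi (Phi (jtheta X)) = jtheta X.
    rewrite (mx22_eta X) Phi_theta PsiE !hB -!rmorphM -!rmorphD.
    by rewrite !mx22E.
  have jdiag c d : jtheta (mx22 (incl c) 0 0 (theta d)) = j1 (mx22 c 0 0 d).
    exact: hAA.1 (c, d).
  suff gid : g =1 idfun by move=> x; rewrite -[LHS]gE gid.
  apply: (universal_amalgam_ext hAA) => [X|Y]; rewrite gE /=; first exact: Psi_theta.
  (* On [mat2 C] it suffices to treat diagonals, which lie in the image of [jtheta] by amalgamation,
     and [e12], for which [hu01] is used. *)
  have [f fE] := starhom_comp g j1; rewrite -[LHS]gE -[LHS]fE; move: Y.
  apply: mat2_hom_ext => [a b|]; rewrite fE /= gE /=.
    by rewrite -jdiag Psi_theta.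
  by rewrite Phi_1 PsiE !rmorph0 !mul0r !addr0 add0r hu01.
exists Phi; split=> //.
- by exists Psi.
- by move=> b; rewrite Phi_theta !rmorph0.
- by rewrite Phi_theta !rmorph0 rmorph1.
Qed.
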